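(* Let $(\mathcal{G},\mathcal{C}_1)$ be a (standard form) CWS code with parameters $((n,K,d))$, and let $\mathcal{B}\subseteq\mathcal{C}_1$ be a linear subcode of $\mathcal{C}_1$ (i.e. a subset closed under bitwise addition modulo 2, containing the zero string) containing $J<K$ codewords. Then there exists a binary code $\mathcal{C}_2\subseteq\{0,1\}^n$ such that the CWS code $(\mathcal{G},\mathcal{C}_2)$, with the same graph $\mathcal{G}$, is an additive code with parameters $((n,K',d))$, where $K'=2J$.
   Context: The $n$-qubit Pauli group consists of the operators $\alpha\,e_1\otimes\cdots\otimes e_n$ with $\alpha\in\{\pm1,\pm i\}$ and $e_i\in\{I,X,Y,Z\}$; the weight of such an operator is the number of indices $i$ with $e_i\ne I$. For $\mathbf{c}\in\{0,1\}^n$, $Z^{\mathbf{c}}=\prod_i Z_i^{c_i}$, where $Z_i$ is $Z$ acting on qubit $i$. Standard form CWS code $(\mathcal{G},\mathcal{C})$: $\mathcal{G}$ is a simple undirected graph on vertices $1,\dots,n$ and $\mathcal{C}\subseteq\{0,1\}^n$ is a binary code containing the all-zeros string. The graph state $|\mathcal{G}\rangle\in(\mathbb{C}^2)^{\otimes n}$ is the unique (up to phase) unit vector fixed by all operators $X_l Z^{\mathbf{r}_l}$, $l=1,\dots,n$, where $\mathbf{r}_l$ is the $l$-th row of the adjacency matrix of $\mathcal{G}$. The code $(\mathcal{G},\mathcal{C})$ is the span of the orthonormal vectors $Z^{\mathbf{c}}|\mathcal{G}\rangle$, $\mathbf{c}\in\mathcal{C}$; its dimension is $K=|\mathcal{C}|$.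 $((n,K,d))$ code: a $K$-dimensional subspace of $(\mathbb{C}^2)^{\otimes n}$, with orthogonal projector $P$, that detects all Pauli errors of weight less than $d$, i.e. for every Pauli operator $E$ of weight $<d$ there is a scalar $\lambda_E$ with $PEP=\lambda_E P$. Additive code (= stabilizer code): a nonzero subspace that is the joint $+1$ eigenspace of an abelian subgroup of the $n$-qubit Pauli group not containing $-I$. *)

(* Defs.v *)
From mathcomp Require Export all_boot all_order all_algebra.
From mathcomp Require Export spectral.
From mathcomp Require Export reals complex.

Set Implicit Arguments.
Unset Strict Implicit.
Unset Printing Implicit Defensive.

Import Order.TTheory GRing.Theory Num.Theory.
Local Open Scope ring_scope.
Local Open Scope sesquilinear_scope.

(* Binary strings of length n, with bitwise addition modulo 2 as [+]. *)
Notation bits n := 'rV['F_2]_n.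

(* The dimension of (C^2)^{(x) n}.  Its computational basis is indexed by bit
   strings through [enum_val] on [bits n]. *)
Definition qdim (n : nat) : nat := #|{: bits n}|.

Lemma qdimE n : qdim n = (2 ^ n)%N.
Proof. by rewrite /qdim card_mx card_Fp // mul1n. Qed.

Section Quantum.
Variables (C : numClosedFieldType) (n : nat).

Notation ket := 'cV[C]_(qdim n).
Notation operator := 'M[C]_(qdim n).

Definition pauliX : 'M[C]_2 := \matrix_(a, b) (a != b)%:R.
Definition pauliZ : 'M[C]_2 := \matrix_(a, b) ((a == b)%:R * (-1) ^+ a).
Definition pauliY : 'M[C]_2 := \matrix_(a, b) ((a != b)%:R * (-1) ^+ b * 'i).

(* e_1 (x) ... (x) e_n : <x| e_1 (x) ... (x) e_n |y> = \prod_i <x_i| e_i |y_i>. *)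
Definition tensor (e : 'I_n -> 'M[C]_2) : operator :=
  \matrix_(s, t) \prod_(i < n)
    e i ((enum_val s : bits n) 0 i) ((enum_val t : bits n) 0 i).

(* The weight is well defined: E determines every [e i]. *)
Definition pauli_of_weight (E : operator) (w : nat) : Prop :=
  exists (a : C) (e : 'I_n -> 'M[C]_2),
    [/\ a \in [:: 1; -1; 'i; - 'i],
        forall i, e i \in [:: 1%:M; pauliX; pauliY; pauliZ],
        E = a *: tensor e
      & #|[set i | e i != 1%:M]| = w].

Definition in_pauli_group (E : operator) : Prop :=
  exists w, pauli_of_weight E w.

Definition on_qubit (A : 'M[C]_2) (l : 'I_n) : operator :=
  tensor (fun i => if i == l then A else 1%:M).

Definition Zstring (c : bits n) : operator :=
  \prod_(i < n) on_qubit pauliZ i ^+ c 0 i.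

Definition adj_row (g : rel 'I_n) (l : 'I_n) : bits n := \row_j (g l j)%:R.

Definition graph_state (g : rel 'I_n) (psi : ket) : Prop :=
  psi ^t* *m psi = 1%:M /\
  forall l, on_qubit pauliX l *m Zstring (adj_row g l) *m psi = psi.

(* V is the standard form CWS code (g, D); changing the phase of the graph
   state psi does not change the span. *)
Definition is_cws_code (g : rel 'I_n) (D : {set bits n}) (V : {vspace ket}) :
    Prop :=
  0 \in D /\
  exists2 psi, graph_state g psi & V = <<[seq Zstring c *m psi | c in D]>>%VS.

Definition is_orthogonal_projector (V : {vspace ket}) (P : operator) : Prop :=
  [/\ P ^t* = P, P *m P = P & limg (linfun (mulmx P : ket -> ket)) = V].

(* ((n, K, d)); the orthogonal projector onto V exists and is unique. *)
Definition has_parameters (V : {vspace ket}) (K d : nat) : Prop :=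
  \dim V = K /\
  exists2 P, is_orthogonal_projector V P &
    forall E w, pauli_of_weight E w -> (w < d)%N ->
      exists lambda : C, P *m E *m P = lambda *: P.

Definition pauli_subgroup (S : operator -> Prop) : Prop :=
  [/\ forall E, S E -> in_pauli_group E,
      S 1%:M,
      forall E F, S E -> S F -> S (E *m F)
    & forall E, S E -> S (invmx E)].

Definition is_additive_code (V : {vspace ket}) : Prop :=
  V != 0%VS /\
  exists S : operator -> Prop,
    [/\ pauli_subgroup S,
        forall E F, S E -> S F -> E *m F = F *m E,
        ~ S (- 1%:M)
      & forall v : ket, v \in V <-> (forall E, S E -> E *m v = v)].

End Quantum.

Definition is_linear_code (n : nat) (B : {set bits n}) : Prop :=
  0 \in B /\ {in B &, forall x y, x + y \in B}.

(* Main.v *)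
(* Pick c in C1 \ B; the code C2 = B u (B + c) is linear with 2J words.  Up to
   sign, a Pauli error X^a Z^b acts on the orthonormal basis Z^x |G> as the
   translation x |-> x + s twisted by the character (-1)^(a.x).  It is detected
   on the span of a set D of labels containing 0 iff s is not a difference of
   two elements of D, or s = 0 and the character is trivial on D.  A character
   trivial on B and c is trivial on C2, and every difference occurring in C2 is
   either b - 0 or b - c with b in B, hence occurs in C1.
   The CWS code of a linear D is additive: for every a orthogonal to D a signed
   graph stabilizer X^a Z^b acts on Z^x |G> as (-1)^(a.x), and these characters
   separate D from its complement. *)

Require Import Defs.
From mathcomp Require Import ring.
Import Order.TTheory GRing.Theory Num.Theory.
Local Open Scope ring_scope.
Local Open Scope sesquilinear_scope.

Set Implicit Arguments.
Unset Strict Implicit.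
Unset Printing Implicit Defensive.

(** * Bits, signs and the dot product over ['F_2] *)

Lemma F2_ind (P : 'F_2 -> Prop) : P 0 -> P 1 -> forall b, P b.
Proof.
move=> P0 P1; case=> [[|[|m]] lt_m] //.
- by rewrite (_ : Ordinal _ = 0) //; apply: val_inj.
- by rewrite (_ : Ordinal _ = 1) //; apply: val_inj.
Qed.

Lemma F2_addxx (b : 'F_2) : b + b = 0.
Proof. by elim/F2_ind: b; apply: val_inj. Qed.

Lemma bits_addxx n (x : bits n) : x + x = 0.
Proof. by apply/rowP=> i; rewrite !mxE F2_addxx. Qed.

Lemma bits_oppE n (x : bits n) : - x = x.
Proof. by apply/esym/eqP; rewrite -addr_eq0 bits_addxx. Qed.

Section Sign.
Variable C : numClosedFieldType.

Definition sgn (b : 'F_2) : C := (-1) ^+ b.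

Lemma sgn0 : sgn 0 = 1. Proof. by []. Qed.
Lemma sgn1 : sgn 1 = -1. Proof. by []. Qed.
Lemma sgnD b c : sgn (b + c) = sgn b * sgn c.
Proof.
elim/F2_ind: b; elim/F2_ind: c;
  rewrite ?addr0 ?add0r ?sgn0 ?sgn1 ?mulr1 ?mul1r //.
by rewrite (_ : 1 + 1 = 0) ?sgn0 ?mulrNN ?mulr1 //; apply: val_inj.
Qed.
Lemma sgnM_id b : sgn b * sgn b = 1.
Proof. by elim/F2_ind: b; rewrite ?sgn0 ?sgn1 ?mulrNN mulr1. Qed.
Lemma sgn_exp4 b : sgn b ^+ 4 = 1.
Proof. by rewrite (exprM _ 2 2) [sgn b ^+ 2]expr2 sgnM_id expr1n. Qed.
Lemma sgn_conj b : (sgn b)^* = sgn b.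
Proof. by elim/F2_ind: b; rewrite ?sgn0 ?sgn1 ?rmorphN rmorph1. Qed.
Lemma sgn_neq0 b : sgn b != 0.
Proof. by elim/F2_ind: b; rewrite ?sgn0 ?sgn1 ?oppr_eq0 oner_eq0. Qed.
Lemma sgn_sum (I : finType) (F : I -> 'F_2) :
  sgn (\sum_i F i) = \prod_i sgn (F i).
Proof. by apply: (big_morph sgn sgnD sgn0). Qed.

End Sign.

Section Dot.
Variable n : nat.
Definition dot (a b : bits n) : 'F_2 := \sum_i a 0 i * b 0 i.

Lemma dotDr a b c : dot a (b + c) = dot a b + dot a c.
Proof. by rewrite -big_split; apply: eq_bigr => i _; rewrite mxE mulrDr. Qed.
Lemma dot0r a : dot a 0 = 0.
Proof. by apply: big1 => i _; rewrite mxE mulr0. Qed.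
Lemma dotC a b : dot a b = dot b a.
Proof. by apply: eq_bigr => i _; rewrite mulrC. Qed.
Lemma dot_deltal i b : dot (delta_mx 0 i) b = b 0 i.
Proof.
rewrite /dot (bigD1 i) //= big1 ?addr0 ?mxE ?eqxx ?mul1r // => j ji.
by rewrite mxE (negPf ji) andbF mul0r.
Qed.
End Dot.

(** * Algebra of tensor products of single-qubit matrices *)

Section Tensor.
Variables (C : numClosedFieldType) (n : nat).
Implicit Types e f : 'I_n -> 'M[C]_2.

Lemma eq_tensor e f : e =1 f -> tensor e = tensor f.
Proof.
move=> ef; apply/matrixP=> s t; rewrite !mxE.
by apply: eq_bigr => i _; rewrite ef.
Qed.

(** Distributivity turns the product over qubits of sums over one bit into a sum over functions from
    qubits to bits; these are the bit strings, hence the basis indices. *)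
Lemma tensor_mul e f : tensor e *m tensor f = tensor (fun i => e i *m f i).
Proof.
apply/matrixP=> s t; rewrite !mxE.
under [RHS]eq_bigr => i _ do rewrite mxE.
rewrite bigA_distr_bigA /=.
rewrite (reindex (fun x : bits n => [ffun i => x 0 i])) /=; last first.
  exists (fun f : {ffun 'I_n -> 'F_2} => \row_i f i) => [x _|h _].
    by apply/rowP=> i; rewrite mxE ffunE.
  by apply/ffunP=> i; rewrite ffunE mxE.
rewrite (reindex_onto (@enum_val _ (mem {: bits n})) enum_rank) /=; last first.
  by move=> x _; apply: enum_rankK.
under [LHS]eq_bigr => k _ do rewrite !mxE -big_split /=.
apply: eq_big => [k|k _]; first by rewrite enum_valK eqxx.
by apply: eq_bigr => i _; rewrite ffunE.
Qed.

Lemma tensor_adj e : (tensor e)^t* = tensor (fun i => (e i)^t*).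
Proof.
apply/matrixP=> s t; rewrite !mxE rmorph_prod.
by apply: eq_bigr => i _; rewrite !mxE.
Qed.

Lemma tensor_scale (k : 'I_n -> C) e :
  tensor (fun i => k i *: e i) = (\prod_i k i) *: tensor e.
Proof.
apply/matrixP=> s t; rewrite !mxE -big_split.
by apply: eq_bigr => i _; rewrite mxE.
Qed.

Lemma tensor1 : tensor (fun _ : 'I_n => 1%:M : 'M[C]_2) = 1%:M.
Proof.
apply/matrixP=> s t; rewrite !mxE -(inj_eq enum_val_inj).
case: eqVneq => [->|]; first by apply: big1 => i _; rewrite mxE eqxx.
apply: contraNeq => /prodf_neq0 /= h; apply/eqP/rowP=> i.
have := h i isT; rewrite mxE.
case: (enum_val s 0 i =P enum_val t 0 i) => /= [->|_] //.
by rewrite mulr0n eqxx.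
Qed.

End Tensor.

Lemma adjmxM (C : numClosedFieldType) m n p (A : 'M[C]_(m, n))
    (B : 'M[C]_(n, p)) :
  (A *m B)^t* = B^t* *m A^t*.
Proof. by rewrite trmx_mul map_mxM. Qed.

Lemma adjmxZ (C : numClosedFieldType) m n k (A : 'M[C]_(m, n)) :
  (k *: A)^t* = k^* *: A^t*.
Proof. by apply/matrixP=> i j; rewrite !mxE rmorphM. Qed.

(** * Pauli operators in the symplectic form X^a Z^b *)

Section Weyl.
Variables (C : numClosedFieldType) (n : nat).

(* [weyl1 a b] is X^a Z^b, as [X |t> = |t + 1>] and [Z |t> = (-1)^t |t>]. *)
Definition weyl1 (a b : 'F_2) : 'M[C]_2 :=
  \matrix_(s, t) (((s : 'F_2) == t + a)%:R * sgn C (b * t)).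

(** The sign is the cost of moving Z^b past X^a'. Only the intermediate basis state [t + a']
    contributes to the matrix product. *)
Lemma weyl1_mul a b a' b' :
  weyl1 a b *m weyl1 a' b' = sgn C (b * a') *: weyl1 (a + a') (b + b').
Proof.
apply/matrixP=> s t; rewrite !mxE (bigD1 ((t : 'F_2) + a')) //= big1 => [|k kt].
  rewrite addr0 !mxE eqxx mul1r (addrC a) addrA mulrDl mulrDr !sgnD !mulrA.
  ring.
by rewrite !mxE (negPf kt) mul0r mulr0.
Qed.

Lemma weyl1_adj a b : (weyl1 a b)^t* = sgn C (a * b) *: weyl1 a b.
Proof.
apply/matrixP=> s t; rewrite !mxE rmorphM rmorph_nat /= sgn_conj.
have [ts|ts] := eqVneq (t : 'F_2) (s + a).
  by rewrite ts -addrA F2_addxx addr0 eqxx !mul1r mulrDr sgnD (mulrC b a) mulrCA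
    sgnM_id mulr1.
rewrite mul0r; have [st|] := eqVneq (s : 'F_2) (t + a).
  by case/eqP: ts; rewrite st -addrA F2_addxx addr0.
by rewrite mul0r mulr0.
Qed.

Lemma weyl1_00 : weyl1 0 0 = 1%:M.
Proof. by apply/matrixP=> s t; rewrite !mxE addr0 mul0r mulr1. Qed.

Lemma weyl1_X : weyl1 1 0 = pauliX C.
Proof.
apply/matrixP=> s t; rewrite !mxE mul0r mulr1.
by elim/F2_ind: s; elim/F2_ind: t.
Qed.

Lemma weyl1_Z : weyl1 0 1 = pauliZ C.
Proof.
apply/matrixP=> s t; rewrite !mxE addr0 mul1r /sgn.
by case: eqP => [->|]; rewrite ?mul0r.
Qed.

Lemma weyl1_Y : 'i *: weyl1 1 1 = pauliY C.
Proof.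
apply/matrixP=> s t; rewrite !mxE mul1r mulrC /sgn.
by elim/F2_ind: s; elim/F2_ind: t.
Qed.

Definition weyl (a b : bits n) : 'M[C]_(qdim n) :=
  tensor (fun i => weyl1 (a 0 i) (b 0 i)).

Lemma weyl_mul a b a' b' :
  weyl a b *m weyl a' b' = sgn C (dot b a') *: weyl (a + a') (b + b').
Proof.
rewrite tensor_mul sgn_sum -tensor_scale; apply: eq_tensor => i.
by rewrite weyl1_mul !mxE.
Qed.

Lemma weyl00 : weyl 0 0 = 1%:M.
Proof. by rewrite -tensor1; apply: eq_tensor => i; rewrite !mxE weyl1_00. Qed.

Lemma weyl_adj a b : (weyl a b)^t* = sgn C (dot a b) *: weyl a b.
Proof.
rewrite tensor_adj sgn_sum -tensor_scale; apply: eq_tensor => i.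
by rewrite weyl1_adj.
Qed.

Lemma weyl_unitary a b : (weyl a b)^t* *m weyl a b = 1%:M.
Proof.
rewrite weyl_adj -scalemxAl weyl_mul scalerA dotC sgnM_id scale1r.
by rewrite !bits_addxx weyl00.
Qed.

(** The exponent is the symplectic form of the two label pairs: any two Pauli operators commute or
    anticommute. *)
Lemma weyl_comm a b a' b' :
  weyl a b *m weyl a' b' =
    sgn C (dot a b' + dot a' b) *: (weyl a' b' *m weyl a b).
Proof.
rewrite !weyl_mul scalerA sgnD mulrAC (dotC a) sgnM_id mul1r (dotC a').
by rewrite (addrC a) (addrC b).
Qed.

Lemma on_qubitX l : on_qubit (pauliX C) l = weyl (delta_mx 0 l) 0.
Proof.
apply: eq_tensor => i; rewrite !mxE /=.
by case: eqP; rewrite ?weyl1_00 ?weyl1_X.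
Qed.

Lemma on_qubitZ l : on_qubit (pauliZ C) l = weyl 0 (delta_mx 0 l).
Proof.
apply: eq_tensor => i; rewrite !mxE /=.
by case: eqP; rewrite ?weyl1_00 ?weyl1_Z.
Qed.

Lemma weyl0D b c : weyl 0 (b + c) = weyl 0 b *m weyl 0 c.
Proof. by rewrite weyl_mul dot0r sgn0 scale1r addr0. Qed.

Lemma ZstringE c : Zstring C c = weyl 0 c.
Proof.
transitivity (weyl 0 (\sum_(i < n) c 0 i *: delta_mx 0 i)); last first.
  by rewrite -row_sum_delta.
rewrite (big_morph (weyl 0) weyl0D weyl00); apply: eq_bigr => i _.
rewrite on_qubitZ; elim/F2_ind: (c 0 i).
  by rewrite scale0r weyl00.
by rewrite scale1r.
Qed.

(** Over ['F_2] a string is a sum of unit vectors, so no scalars have to be treated. *)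
Lemma bits_ind (P : bits n -> Prop) :
    P 0 -> (forall l, P (delta_mx 0 l)) ->
    (forall b c, P b -> P c -> P (b + c)) ->
  forall a, P a.
Proof.
move=> P0 Pd PD a; rewrite [a]row_sum_delta; apply: big_ind => // i _.
by elim/F2_ind: (a 0 i); rewrite ?scale0r ?scale1r.
Qed.

(** The Pauli phases are the fourth roots of unity; in this form closure under products and inverses
    is a computation with exponents. *)
Lemma mem_phases (k : C) : (k \in [:: 1; -1; 'i; - 'i]) = (k ^+ 4 == 1).
Proof.
rewrite -subr_eq0 (_ : k ^+ 4 - 1 = (k - 1) * (k + 1) * ((k - 'i) * (k + 'i))).
  by rewrite !mulf_eq0 !subr_eq0 !addr_eq0 !inE orbA.
by rewrite -!subr_sqr sqrCi expr1n; ring.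
Qed.

(** I, X and Z are [weyl1] matrices and Y is ['i] times one, so a Pauli operator and its [weyl]
    counterpart differ by a phase only. *)
Lemma pauli_weyl E : in_pauli_group E <->
  exists k a b, k ^+ 4 = 1 /\ E = k *: weyl a b.
Proof.
split=> [[w [k [e [kP eP -> _]]]]|[k [a [b [k4 ->]]]]].
  have /fin_all_exists [c cP] i : exists c : C * 'F_2 * 'F_2,
      c.1.1 ^+ 4 = 1 /\ e i = c.1.1 *: weyl1 c.1.2 c.2.
    have := eP i; rewrite !inE => /or4P[]/eqP->.
    - by exists (1, 0, 0); rewrite expr1n weyl1_00 scale1r.
    - by exists (1, 1, 0); rewrite expr1n weyl1_X scale1r.
    - exists ('i, 1, 1); rewrite weyl1_Y; split => //; apply/eqP.
      by rewrite -mem_phases !inE eqxx !orbT.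
    - by exists (1, 0, 1); rewrite expr1n weyl1_Z scale1r.
  exists (k * \prod_i (c i).1.1), (\row_i (c i).1.2), (\row_i (c i).2); split.
    rewrite exprMn (eqP (_ : k ^+ 4 == 1)) -?mem_phases // mul1r -prodrXl.
    by apply: big1 => i _; case: (cP i).
  rewrite -scalerA -tensor_scale; congr (_ *: _); apply: eq_tensor => i.
  by rewrite !mxE; case: (cP i).
(* [y] marks the qubits that carry Y. The factors ['i] that they need are divided out of the global
   phase. *)
pose y i := (a 0 i == 1) && (b 0 i == 1).
pose e i : 'M[C]_2 := (if y i then 'i else 1) *: weyl1 (a 0 i) (b 0 i).
exists #|[set i | e i != 1%:M]|, (k / \prod_i (if y i then 'i else 1)), e.
split=> // [|i|].
- rewrite mem_phases exprMn k4 mul1r exprVn -prodrXl big1 ?invr1 // => i _.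
  by apply/eqP; rewrite -mem_phases; case: (y i); rewrite !inE eqxx ?orbT.
- rewrite /e /y !inE; elim/F2_ind: (a 0 i); elim/F2_ind: (b 0 i);
  by rewrite /= ?scale1r ?weyl1_00 ?weyl1_X ?weyl1_Z ?weyl1_Y ?eqxx ?orbT.
rewrite tensor_scale scalerA divfK //; apply/prodf_neq0 => i _.
by case: (y i); rewrite ?neq0Ci ?oner_neq0.
Qed.

End Weyl.

(** * Orthonormal families, their spans and projectors, and error detection *)

Section Orthonormal.
Variables (C : numClosedFieldType) (n : nat) (T : finType).
Notation m := (qdim n).
Variable e : T -> 'cV[C]_m.
Hypothesis gram : forall x y, (e x)^t* *m e y = (x == y)%:R%:M.
Implicit Types (D : {set T}) (P E : 'M[C]_m).

(** The functional given by the inner product with [e x] kills every other member, hence their span,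
    but takes the value 1 at [e x]. *)
Lemma orthonormal_free (s : seq T) : uniq s -> free (map e s).
Proof.
elim: s => [|x s IHs] /=; first by rewrite nil_free.
case/andP=> xs us; rewrite free_cons IHs // andbT; apply/negP=> ex.
have /subvP/(_ _ ex) :
    (<<map e s>> <= lker (linfun (mulmx ((e x)^t* ) : 'cV_m -> 'M_1)))%VS.
  apply/span_subvP=> _ /mapP[y ys ->]; rewrite memv_ker lfunE /= gram.
  by case: (eqVneq x y) xs => [->|_ _]; rewrite ?ys // mulr0n raddf0.
rewrite memv_ker lfunE /= gram eqxx => /eqP/matrixP/(_ 0 0)/eqP.
by rewrite !mxE oner_eq0.
Qed.

Definition span_of D : {vspace 'cV[C]_m} := <<[seq e x | x in D]>>%VS.

Lemma mem_span_of D x : x \in D -> e x \in span_of D.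
Proof. by move=> xD; apply/memv_span/image_f. Qed.

Lemma span_of_sub D (U : {vspace 'cV[C]_m}) :
  (forall x, x \in D -> e x \in U) -> (span_of D <= U)%VS.
Proof. by move=> DU; apply/span_subvP=> _ /imageP[x xD ->]; apply: DU. Qed.

Lemma dim_span_of D : \dim (span_of D) = #|D|.
Proof.
by have /eqP := orthonormal_free (enum_uniq (mem D)); rewrite size_map -cardE.
Qed.

Definition proj_of D : 'M[C]_m := \sum_(x in D) e x *m (e x)^t*.

Lemma proj_of_basis D y : proj_of D *m e y = (y \in D)%:R *: e y.
Proof.
rewrite mulmx_suml; have [yD|yD] := boolP (y \in D).
  rewrite (bigD1 y) //= -mulmxA gram eqxx mulmx1 big1 ?addr0 ?scale1r // => x.
  by case/andP=> _ xy; rewrite -mulmxA gram (negPf xy) mulr0n raddf0 mulmx0.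
rewrite scale0r big1 // => x xD; rewrite -mulmxA gram.
by case: (eqVneq x y) yD => [<-|_ _]; rewrite ?xD // mulr0n raddf0 mulmx0.
Qed.

Lemma proj_of_adj D : (proj_of D)^t* = proj_of D.
Proof.
rewrite /proj_of raddf_sum raddf_sum /=; apply: eq_bigr => x _.
by rewrite adjmxM trmxCK.
Qed.

Lemma proj_ofP D : is_orthogonal_projector (span_of D) (proj_of D).
Proof.
split; first exact: proj_of_adj.
  rewrite {2 3}/proj_of mulmx_sumr; apply: eq_bigr => x xD.
  by rewrite mulmxA proj_of_basis xD scale1r.
apply/eqP; rewrite eqEsubv; apply/andP; split.
  apply/subvP=> _ /memv_imgP[v _ ->]; rewrite lfunE /= mulmx_suml.
  apply: memv_suml => x xD; rewrite -mulmxA [_ *m v]mx11_scalar mul_mx_scalar.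
  exact/memvZ/mem_span_of.
apply: span_of_sub => x xD; apply/memv_imgP; exists (e x); rewrite ?memvf //.
by rewrite lfunE /= proj_of_basis xD scale1r.
Qed.

(** The Knill-Laflamme conditions for an arbitrary projector [P] onto the span: [P] fixes each [e x]
    from the left and its adjoint from the right, so it can be inserted on both sides of [E]. *)
Lemma projector_detect D P E l :
    is_orthogonal_projector (span_of D) P -> P *m E *m P = l *: P ->
  {in D &, forall x y, (e x)^t* *m E *m e y = (l * (x == y)%:R)%:M}.
Proof.
move=> [Padj P2 Pimg] PEP.
have Pe x : x \in D -> P *m e x = e x.
  move=> /mem_span_of; rewrite -Pimg => /memv_imgP[v _ ->].
  by rewrite lfunE /= mulmxA P2.
have eP x : x \in D -> (e x)^t* *m P = (e x)^t*.
  by move=> /Pe {2}<-; rewrite adjmxM Padj.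
move=> x y xD yD; rewrite -(eP x) // -{1}(Pe y) // !mulmxA -(mulmxA _ P E).
rewrite -(mulmxA _ _ P) PEP -scalemxAr -scalemxAl eP // gram.
by rewrite scale_scalar_mx.
Qed.

(** Conversely, when both copies of [proj_of D] are expanded, only the diagonal terms survive, each
    with the factor [l]. *)
Lemma proj_of_detect D E l :
    {in D &, forall x y, (e x)^t* *m E *m e y = (l * (x == y)%:R)%:M} ->
  proj_of D *m E *m proj_of D = l *: proj_of D.
Proof.
move=> xEy.
have term x y : x \in D -> y \in D -> e x *m (e x)^t* *m E *m (e y *m (e y)^t* )
    = (l * (x == y)%:R) *: (e x *m (e y)^t* ).
  move=> xD yD; transitivity (e x *m ((e x)^t* *m E *m e y) *m (e y)^t* ).
    by rewrite !mulmxA.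
  by rewrite xEy // mul_mx_scalar -scalemxAl.
rewrite /proj_of !mulmx_suml scaler_sumr; apply: eq_bigr => x xD.
rewrite mulmx_sumr (bigD1 x) //= big1 ?addr0 => [|y /andP[yD yx]].
  by rewrite term // eqxx mulr1.
by rewrite term // eq_sym (negPf yx) mulr0 scale0r.
Qed.

(** By dimension the family spans the whole space, so [v] lies in the image of the projector and is
    fixed by it. *)
Lemma orthonormal_basis_expand (v : 'cV[C]_m) :
  #|T| = m -> v = \sum_x e x *m ((e x)^t* *m v).
Proof.
move=> cardT; have [_ P2 Pimg] := proj_ofP [set: T].
have spanT : span_of [set: T] = fullv.
  apply/eqP; rewrite eqEdim subvf dim_span_of cardsT cardT dimvf dim_matrix.
  by rewrite mulr1 leqnn.
have : v \in limg (linfun (mulmx (proj_of setT) : 'cV[C]_m -> 'cV[C]_m)).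
  by rewrite Pimg spanT memvf.
case/memv_imgP=> w _ ->; rewrite lfunE /= -[in LHS]P2 -mulmxA.
rewrite {1}/proj_of mulmx_suml.
by apply: eq_big => x; rewrite ?inE // -mulmxA.
Qed.

End Orthonormal.

(** * The graph basis and the action of Pauli operators on it *)

Section GraphState.
Variables (C : numClosedFieldType) (n : nat) (g : rel 'I_n).
Variable psi : 'cV[C]_(qdim n).
Hypothesis graph_psi : graph_state g psi.

Definition graph_basis (x : bits n) : 'cV[C]_(qdim n) := weyl C 0 x *m psi.

(** Multiplying the generators X_l Z^(r_l) realizes every X-part [a] in an operator that fixes [psi]
    up to sign. *)
Lemma graph_stabilizer a :
  exists s (eps : 'F_2), weyl C a s *m psi = sgn C eps *: psi.
Proof.
elim/bits_ind: a => [|l|a b [s [eps sP]] [t [eta tP]]].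
- by exists 0, 0; rewrite weyl00 mul1mx scale1r.
- exists (adj_row g l), 0; have [_ /(_ l)] := graph_psi.
  by rewrite on_qubitX ZstringE weyl_mul dot0r !scale1r addr0 add0r.
(* The term [dot s b] is the reordering sign from merging the two operators. *)
exists (s + t), (dot s b + eta + eps).
have <- : sgn C (dot s b) *: (weyl C a s *m weyl C b t)
    = weyl C (a + b) (s + t).
  by rewrite weyl_mul scalerA sgnM_id scale1r.
by rewrite -scalemxAl -mulmxA tP -scalemxAr sP !scalerA !sgnD.
Qed.

(** The inner product is the expectation of Z^(x+y) in [psi]. For distinct labels some stabilizer up
    to sign anticommutes with this operator, so the expectation equals its own negative. *)
Lemma graph_basis_gram x y :
  (graph_basis x)^t* *m graph_basis y = (x == y)%:R%:M.
Proof.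
have [norm1 _] := graph_psi.
rewrite adjmxM weyl_adj (dotC 0) dot0r scale1r mulmxA.
rewrite -(mulmxA _ _ (weyl _ _ _)) -weyl0D.
have [->|xy] := eqVneq x y; first by rewrite bits_addxx weyl00 mulmx1.
set z := x + y; have /existsP[i /eqP zi] : [exists i, z 0 i == 1].
  apply: contraNT xy; rewrite negb_exists => /forallP z0.
  rewrite -subr_eq0 bits_oppE; apply/eqP/rowP=> i; rewrite [RHS]mxE.
  by have := z0 i; rewrite -/z; elim/F2_ind: (z 0 i).
(* An X on a qubit [i] where [z] is 1 gives the anticommutation; the Z-part [s] has no influence on
   it. *)
have [s [eps sP]] := graph_stabilizer (delta_mx 0 i).
set W := weyl _ _ s in sP.
have WzW : (W *m psi)^t* *m weyl C 0 z *m (W *m psi)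
    = sgn C 1 *: (psi^t* *m weyl C 0 z *m psi).
  rewrite adjmxM -!mulmxA (mulmxA (weyl C 0 z)) weyl_comm.
  rewrite (dotC 0 s) dot0r add0r dot_deltal zi -scalemxAl -!scalemxAr.
  by rewrite -!mulmxA (mulmxA _ W) weyl_unitary mul1mx.
move: WzW; rewrite sP adjmxZ sgn_conj -!scalemxAl -scalemxAr scalerA.
rewrite sgnM_id scale1r sgn1 scaleN1r => /eqP; rewrite -addr_eq0 -mulr2n.
by rewrite -scaler_nat scaler_eq0 pnatr_eq0 /= => /eqP->; rewrite mulr0n raddf0.
Qed.

(** Up to sign X^a Z^b is Z^(b+t) times X^a Z^t, where the latter fixes [psi] up to sign. Moving it
    past Z^y gives the character, and Z^(b+t) gives the translation. *)
Lemma weyl_graph_basis a b : exists s (eps : 'F_2), forall y,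
  weyl C a b *m graph_basis y = sgn C (eps + dot a y) *: graph_basis (y + s).
Proof.
have [t [eps tP]] := graph_stabilizer a.
exists (b + t), (dot (b + t) a + eps) => y; rewrite /graph_basis.
have <- : sgn C (dot (b + t) a) *: (weyl C 0 (b + t) *m weyl C a t)
    = weyl C a b.
  by rewrite weyl_mul scalerA sgnM_id scale1r add0r -addrA bits_addxx addr0.
rewrite -scalemxAl mulmxA -(mulmxA (weyl C 0 (b + t))) weyl_comm (dotC 0) dot0r.
rewrite addr0 -scalemxAr mulmxA -weyl0D -scalemxAl -mulmxA tP -scalemxAr.
by rewrite !scalerA !sgnD (addrC y); congr (_ *: _); ring.
Qed.

(** Absorbing the sign [eps] makes the eigenvalue at label 0 equal to 1, so the eigenvalues form
    exactly the character of [a]. *)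
Lemma graph_stabilizer_basis a : exists b (eps : 'F_2), forall y,
  (sgn C eps *: weyl C a b) *m graph_basis y = sgn C (dot a y) *: graph_basis y.
Proof.
have [b [eps bP]] := graph_stabilizer a; exists b, eps => y.
rewrite /graph_basis -scalemxAl mulmxA weyl_comm (dotC 0) dot0r addr0.
by rewrite -scalemxAl -mulmxA bP -!scalemxAr !scalerA mulrAC sgnM_id mul1r.
Qed.

End GraphState.

(** * Linear label sets give stabilizer codes *)

Section Codes.
Variables (C : numClosedFieldType) (n : nat) (g : rel 'I_n).
Variable psi : 'cV[C]_(qdim n).
Hypothesis graph_psi : graph_state g psi.

Let gram := graph_basis_gram graph_psi.
Notation code := (span_of (graph_basis psi)).

Lemma Zstring_span (D : {set bits n}) :
  <<[seq Zstring C c *m psi | c in D]>>%VS = code D.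
Proof.
by congr (<<_>>%VS); apply: eq_map => c; rewrite ZstringE.
Qed.

(** A parity check of [D] that [x] violates. It is a column of the cokernel of the matrix whose rows
    are the codewords. *)
Lemma linear_code_separation (D : {set bits n}) x :
    is_linear_code D -> x \notin D ->
  exists2 a, {in D, forall y, dot a y = 0} & dot a x = 1.
Proof.
move=> [D0 DD] xD; pose M := \matrix_(i < #|D|) enum_val i.
have MD y : y \in D -> (y <= M)%MS.
  by move=> yD; rewrite -(enum_rankK_in yD yD)
    -(rowK (fun i : 'I_#|D| => enum_val i)) row_sub.
(* Closure under addition makes the row space of [M] no larger than [D]. *)
have xM : ~~ (x <= M)%MS.
  apply: contra xD => /submxP[u ->]; rewrite mulmx_sum_row.
  apply: (big_ind (fun y => y \in D)) => // i _; rewrite rowK.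
  by elim/F2_ind: (u 0 i); rewrite ?scale0r ?scale1r // enum_valP.
have dotE y j : dot (col j (cokermx M))^T y = (y *m cokermx M) 0 j.
  by rewrite !mxE; apply: eq_bigr => i _; rewrite !mxE mulrC.
move: xM; rewrite submxE => /rV0Pn[j xj].
exists (col j (cokermx M))^T => [y yD|].
  by have := MD y yD; rewrite dotE submxE => /eqP->; rewrite mxE.
by rewrite dotE; move: xj; elim/F2_ind: (_ 0 j).
Qed.

Lemma linear_cws_additive (D : {set bits n}) : is_linear_code D ->
  is_additive_code (code D).
Proof.
move=> linD; have [D0 _] := linD.
have nz0 : graph_basis psi 0 != 0.
  apply: contra_eq_neq (gram 0 0) => ->; rewrite eqxx mulmx0 eq_sym.
  by rewrite -scalemx1 scale1r; apply: oner_neq0.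
have code0 := mem_span_of (graph_basis psi) D0.
split; first by apply: contraNneq nz0 => V0; rewrite -memv0 -V0.
have fixes_mul A A' (v : 'cV[C]_(qdim n)) :
    A *m v = v -> A' *m v = v -> A *m A' *m v = v.
  by move=> Av A'v; rewrite -mulmxA A'v.
(* The stabilizer is taken as large as possible: all Pauli operators that fix the code pointwise. *)
exists (fun E => in_pauli_group E /\ {in code D, forall v, E *m v = v}); split.
- split=> [E []//||E F [PE fE] [PF fF]|E [PE fE]].
  + split=> [|v _]; last by rewrite mul1mx.
    by apply/pauli_weyl; exists 1, 0, 0; rewrite expr1n weyl00 scale1r.
  + split=> [|v vD]; last by apply: fixes_mul; [apply: fE|apply: fF].
    have /pauli_weyl[k [a [b [k4 ->]]]] := PE.
    have /pauli_weyl[l [a' [b' [l4 ->]]]] := PF.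
    apply/pauli_weyl; exists (k * l * sgn C (dot b a')), (a + a'), (b + b').
    rewrite !exprMn k4 l4 !mul1r; split; first by rewrite sgn_exp4.
    by rewrite -scalemxAl -scalemxAr weyl_mul !scalerA.
  + have /pauli_weyl[k [a [b [k4 defE]]]] := PE.
    (* Since [k ^+ 4 = 1], the inverse of [k] is [k ^+ 3], and [weyl] is unitary; this explicit
       inverse is visibly a Pauli operator. *)
    have VE : (k ^+ 3 *: (weyl C a b)^t* ) *m E = 1%:M.
      by rewrite defE -scalemxAl -scalemxAr weyl_unitary scalerA -exprSr k4
        scale1r.
    have uE : E \in unitmx by case/mulmx1_unit: VE.
    have -> : invmx E = k ^+ 3 *: (weyl C a b)^t*.
      by rewrite -[LHS]mul1mx -VE mulmxK.
    split=> [|v vD]; last by rewrite -{1}(fE v vD) mulmxA VE mul1mx.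
    rewrite weyl_adj scalerA; apply/pauli_weyl.
    exists (k ^+ 3 * sgn C (dot a b)), a, b; split=> //.
    by rewrite exprMn -exprM mulnC exprM k4 expr1n mul1r sgn_exp4.
- move=> E F [PE fE] [PF fF].
  have /pauli_weyl[k [a [b [k4 defE]]]] := PE.
  have /pauli_weyl[l [a' [b' [l4 defF]]]] := PF.
  have EF : E *m F = sgn C (dot a b' + dot a' b) *: (F *m E).
    rewrite defE defF -!scalemxAl -!scalemxAr weyl_comm !scalerA.
    by congr (_ *: _); ring.
  (* The sign cannot be -1, because both products fix the nonzero code vector with label 0. *)
  suff EF1 : sgn C (dot a b' + dot a' b) = 1 by rewrite EF EF1 scale1r.
  have := congr1 (fun A => A *m graph_basis psi 0) EF.
  rewrite -scalemxAl !fixes_mul ?fE ?fF //; elim/F2_ind: (_ + _) => //.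
  rewrite sgn1 scaleN1r => /eqP; rewrite -addr_eq0 -mulr2n -scaler_nat.
  by rewrite scaler_eq0 pnatr_eq0 (negPf nz0).
- move=> [_ /(_ _ code0)/eqP]; rewrite mulNmx mul1mx eq_sym -addr_eq0 -mulr2n.
  by rewrite -scaler_nat scaler_eq0 pnatr_eq0 (negPf nz0).
move=> v; split=> [vD E [_ fE]|vS]; first exact: fE.
(* It remains to see that the component of [v] at each label outside [D] vanishes. *)
rewrite (orthonormal_basis_expand gram v) //; apply: memv_suml => x _.
have [xD|xD] := boolP (x \in D).
  by rewrite [_ *m v]mx11_scalar mul_mx_scalar; apply/memvZ/mem_span_of.
have [a aD ax] := linear_code_separation linD xD.
have [b [eps bP]] := graph_stabilizer_basis graph_psi a.
set E := _ *: _ in bP.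
have Ev : E *m v = v.
  apply: vS; split=> [|w wD].
    apply/pauli_weyl; exists (sgn C eps), a, b; split=> //.
    by rewrite sgn_exp4.
  (* The vectors fixed by [E] form a kernel, so checking the basis vectors of the code suffices. *)
  pose defect := linfun (mulmx (E - 1%:M) : 'cV[C]_(qdim n) -> 'cV[C]_(qdim n)).
  have /subvP/(_ _ wD) : (code D <= lker defect)%VS.
    apply: span_of_sub => y yD; rewrite memv_ker lfunE /= mulmxBl mul1mx bP.
    by rewrite aD // scale1r subrr.
  by rewrite memv_ker lfunE /= mulmxBl mul1mx subr_eq0 => /eqP.
have UE : E^t* *m E = 1%:M.
  by rewrite adjmxZ sgn_conj -scalemxAl -scalemxAr weyl_unitary scalerA sgnM_id
    scale1r.
(* [E] is unitary, fixes [v] and negates the basis vector at [x], so the component equals its own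
   negative. *)
have : (graph_basis psi x)^t* *m v = - ((graph_basis psi x)^t* *m v).
  rewrite -{1}[v]mul1mx -UE -mulmxA Ev mulmxA -adjmxM bP ax adjmxZ.
  by rewrite sgn_conj -scalemxAl sgn1 scaleN1r.
move/eqP; rewrite -addr_eq0 -mulr2n -scaler_nat scaler_eq0 pnatr_eq0 => /eqP->.
by rewrite mulmx0 mem0v.
Qed.

(** * Adjoining one coset to a linear code *)

Definition extend_code (B : {set bits n}) c := B :|: [set b + c | b in B].

Lemma extend_code_linear B c :
  is_linear_code B -> is_linear_code (extend_code B c).
Proof.
move=> [B0 BD]; split=> [|x y]; first by rewrite inE B0.
have coset b : b \in B -> b + c \in [set b + c | b in B].
  by move=> bB; apply: (imset_f (+%R^~ c)).
rewrite !inE => /orP[xB|/imsetP[b bB ->]] /orP[yB|/imsetP[b' bB' ->]].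
- by rewrite BD.
- by rewrite addrA coset ?orbT ?BD.
- by rewrite addrAC coset ?orbT ?BD.
by rewrite addrACA bits_addxx addr0 BD.
Qed.

Lemma card_extend_code B c : is_linear_code B -> c \notin B ->
  #|extend_code B c| = (2 * #|B|)%N.
Proof.
move=> [B0 BD] cB; rewrite cardsU card_imset; last exact: addIr.
rewrite (_ : _ :&: _ = set0) ?cards0 ?subn0 ?mul2n ?addnn //.
apply/setP=> x; rewrite !inE; apply/negP=> /andP[xB /imsetP[b bB xE]].
(* A common element [x = b + c] would give [c = b + x], which lies in [B]. *)
by case/negP: cB; rewrite -[c]add0r -(bits_addxx b) -addrA -xE BD.
Qed.

(** [k != 0] is recorded so that a vanishing matrix element forces [x] and [y + s] to differ. *)
Lemma graph_basis_weyl_elements E : in_pauli_group E ->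
  exists s a (k : C), k != 0 /\ forall x y,
    (graph_basis psi x)^t* *m E *m graph_basis psi y
      = (k * sgn C (dot a y) * (x == y + s)%:R)%:M.
Proof.
move=> /pauli_weyl[k [a [b [k4 ->]]]].
have [s [eps sP]] := weyl_graph_basis graph_psi a b.
exists s, a, (k * sgn C eps); split=> [|x y].
  rewrite mulf_neq0 ?sgn_neq0 //; apply: contra_eq_neq k4 => ->.
  by rewrite expr0n eq_sym oner_neq0.
rewrite -mulmxA -scalemxAl sP -!scalemxAr gram scalerA !scale_scalar_mx sgnD.
by rewrite !mulrA.
Qed.

Lemma extend_code_detects (D B : {set bits n}) c E l :
    is_linear_code B -> B \subset D -> c \in D -> in_pauli_group E ->
    {in D &, forall x y, (graph_basis psi x)^t* *m E *m graph_basis psi y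
                           = (l * (x == y)%:R)%:M} ->
  exists l', {in extend_code B c &, forall x y,
    (graph_basis psi x)^t* *m E *m graph_basis psi y = (l' * (x == y)%:R)%:M}.
Proof.
move=> linB /subsetP sBD cD /graph_basis_weyl_elements[s [a [k [k0 EE]]]] detD.
have [B0 BD] := linB; have D0 := sBD _ B0.
have {}detD x y : x \in D -> y \in D ->
    k * sgn C (dot a y) * (x == y + s)%:R = l * (x == y)%:R.
  move=> xD yD; have := detD x y xD yD; rewrite EE => /matrixP/(_ 0 0).
  by rewrite !mxE.
have [s0|s0] := eqVneq s 0.
  (* Without translation, detection makes all diagonal entries on [D] equal; comparison with label 0
     makes the character trivial there. *)
  have ay y : y \in D -> dot a y = 0.
    move=> yD; have := detD y y yD yD; have := detD 0 0 D0 D0.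
    rewrite s0 !addr0 !eqxx !mulr1 dot0r mulr1 => <-.
    elim/F2_ind: (dot a y) => // /eqP; rewrite sgn1 mulrN1 eq_sym -addr_eq0.
    by rewrite -mulr2n mulrn_eq0 (negPf k0).
  exists k => x y _ yD; rewrite EE s0 addr0 (_ : dot a y = 0) ?mulr1 //.
  move: yD; rewrite inE => /orP[/sBD/ay //|/imsetP[b /sBD bD ->]].
  by rewrite dotDr !ay // addr0.
(* For [s] nonzero all matrix elements on the extended code vanish, because [s] is not a difference
   of two of its words. *)
exists 0 => x y xD yD; rewrite EE mul0r.
case: (eqVneq x (y + s)) => [xs|_]; last by rewrite mulr0.
(* Labels of [D] that differ by [s] would be distinct, yet their matrix element is [k] up to sign
   and hence nonzero. *)
have absurd u v : u \in D -> v \in D -> u <> v + s.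
  move=> uD vD us; have := detD u v uD vD; rewrite us eqxx mulr1.
  rewrite -subr_eq0 [v + s - v]addrAC subrr add0r (negPf s0) mulr0 => /eqP.
  by rewrite mulf_eq0 (negPf k0) (negPf (sgn_neq0 _ _)).
have : s \in extend_code B c.
  have -> : s = x + y by rewrite xs addrAC bits_addxx add0r.
  by case: (extend_code_linear c linB) => _; apply.
(* In [B], [s] is the difference of [s] and 0; in the coset, it is the difference of [b] and [c].
   Both pairs lie in [D]. *)
rewrite inE => /orP[sB|/imsetP[b bB sE]].
  by case: (absurd s 0 (sBD s sB) D0); rewrite add0r.
by case: (absurd b c (sBD b bB) cD); rewrite sE addrCA bits_addxx addr0.
Qed.

End Codes.

(** * Assembly of the extended code and its parameters *)

Theorem theorem8 (R : realType) (n : nat) (g : rel 'I_n)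
    (g_sym : symmetric g) (g_irr : irreflexive g)
    (C1 : {set bits n}) (V1 : {vspace 'cV[R[i]]_(qdim n)}) (K d : nat)
    (cwsV1 : is_cws_code g C1 V1) (parV1 : has_parameters V1 K d)
    (B : {set bits n}) (J : nat)
    (linB : is_linear_code B) (sBC1 : B \subset C1)
    (cardB : #|B| = J) (ltJK : (J < K)%N) :
  exists (C2 : {set bits n}) (V2 : {vspace 'cV[R[i]]_(qdim n)}),
    [/\ is_cws_code g C2 V2,
        is_additive_code V2
      & has_parameters V2 (2 * J)%N d].
Proof.
have [C1_0 [psi graph_psi V1E]] := cwsV1; have [dimV1 [P projP detP]] := parV1.
have gram := graph_basis_gram graph_psi.
rewrite Zstring_span in V1E.
(* [K] is the number of codewords of [C1], so [J < K] leaves a word of [C1] outside [B]. *)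
have /subsetPn[c cC1 cB] : ~~ (C1 \subset B).
  apply: contraL ltJK => /subset_leq_card; rewrite -leqNgt.
  by rewrite -dimV1 V1E dim_span_of // cardB.
have linC2 := extend_code_linear c linB; have [C2_0 _] := linC2.
exists (extend_code B c), (span_of (graph_basis psi) (extend_code B c)); split.
- by split=> //; exists psi; rewrite ?Zstring_span.
- exact: (linear_cws_additive graph_psi).
split; first by rewrite dim_span_of // card_extend_code ?cardB.
exists (proj_of (graph_basis psi) (extend_code B c)); first exact: proj_ofP.
move=> E w Ew wd; have [l PEP] := detP E w Ew wd.
rewrite V1E in projP.
(* Detection by the given projector [P] is read off as matrix elements on [C1], carried over to the
   extended code, and turned back into a statement on its explicit projector. *)
have [l' l'P] := extend_code_detects graph_psi linB sBC1 cC1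
  (ex_intro _ w Ew) (projector_detect gram projP PEP).
by exists l'; apply: proj_of_detect l'P.
Qed.
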